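(* Let $\iota:\mathcal N\to\mathcal M$ be a morphism of von Neumann algebras and let $E\in\mathcal E(\mathcal M,\iota(\mathcal N))$ with finite index. Let $$E'':=\frac{1}{E(\mathrm{Ind}(E))}\,E(\mathrm{Ind}(E)\,\cdot\,)\in\mathcal E(\mathcal M,\iota(\mathcal N))$$ be the bidual expectation of $E$. Then $E=E''$ if and only if $E(\mathrm{Ind}(E))=\mathrm{Ind}(E)$.
   Context: All von Neumann algebras have separable predual. A morphism $\iota:\mathcal N\to\mathcal M$ is a normal injective unital $*$-homomorphism of von Neumann algebras; $\mathcal M$ acts on a Hilbert space $H$ and commutants are taken in $B(H)$; $Z(\mathcal A)=\mathcal A\cap\mathcal A'$. For a unital inclusion $\mathcal A\subset\mathcal B$ of von Neumann algebras on $H$, a conditional expectation of $\mathcal B$ onto $\mathcal A$ is a unital completely positive map $E:\mathcal B\to\mathcal B$ with $E(\mathcal B)=\mathcal A$ and $E(a_1ba_2)=a_1E(b)a_2$ for $a_i\in\mathcal A$, $b\in\mathcal B$. $\mathcal E(\mathcal B,\mathcal A)$ denotes the set of normal (ultraweakly continuous) faithful ($E(b^*b)=0\Rightarrow b=0$) ones. For $E\in\mathcal E(\mathcal B,\mathcal A)$, $E^{-1}$ denotes the normal faithful semifinite operator-valued weight from $\mathcal A'$ onto $\mathcal B'$ characterized by the equality of Connes' spatial derivatives $\frac{d(\varphi\circ E)}{d\psi}=\frac{d\varphi}{d(\psi\circ E^{-1})}$, for $\varphi,\psi$ normal faithful semifinite weights on $\mathcal A$ and $\mathcal B'$, respectively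 (it does not depend on $\varphi,\psi$). The index is $\mathrm{Ind}(E):=E^{-1}(1)$, an element of the extended positive part of $Z(\mathcal B)$. $E$ has finite index if $\mathrm{Ind}(E)$ is a (bounded) element of $Z(\mathcal B)$; then it is invertible and $\mathrm{Ind}(E)\ge1$, and the dual expectation of $E$ is $E':=\mathrm{Ind}(E)^{-1}E^{-1}\in\mathcal E(\mathcal A',\mathcal B')$. The bidual expectation $E''$ is obtained by normalizing $(E')^{-1}$, i.e. it is the dual expectation of $E'$; it is given by the formula displayed in the claim. *)

(* Defs.v *)
From HB Require Import structures.
From mathcomp Require Import all_boot all_order all_algebra.
From mathcomp Require Import complex.
From mathcomp Require Import all_classical all_reals all_analysis.

Set Implicit Arguments.
Unset Strict Implicit.
Unset Printing Implicit Defensive.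

Import Order.TTheory GRing.Theory Num.Theory.
Import numFieldNormedType.Exports.

Local Open Scope classical_set_scope.
Local Open Scope ring_scope.

(* Complex Hilbert spaces; the inner product is linear in its first argument. *)
HB.mixin Record CompleteNormedModule_isHilbert (R : realType) H
    of CompleteNormedModule R[i] H := {
  inner : H -> H -> R[i];
  inner_linearl : forall (a : R[i]) (x y z : H),
    inner (a *: x + y) z = a * inner x z + inner y z;
  inner_conj : forall x y : H, inner y x = Num.conj (inner x y);
  inner_norm : forall x : H, inner x x = `|x| ^+ 2
}.

#[short(type="hilbertType")]
HB.structure Definition Hilbert (R : realType) :=
  { H of CompleteNormedModule R[i] H & CompleteNormedModule_isHilbert R H }.

(* R[i]^o is R[i] with its usual topology *)

(* Operators on H are plain functions H -> H, and sets of operators always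
   consist of bounded linear ones. A map "on A", for A a set of operators, is a
   function on all of H -> H of which only the values on A matter. *)
Section Operators.
Context {R : realType} {H : hilbertType R}.
Implicit Types (A B : set (H -> H)) (S T x y a b : H -> H).

Definition bounded_operator T : Prop :=
  linear T /\ exists c : R[i], forall v, `|T v| <= c * `|v|.

Definition is_adjoint S T : Prop :=
  forall v w : H, inner (S v) w = inner v (T w).

Definition op_le S T : Prop := forall v : H, inner (S v) v <= inner (T v) v.

Definition positive_part A : set (H -> H) := [set T | A T /\ op_le 0 T].

Definition commutant A : set (H -> H) :=
  [set S | bounded_operator S /\ forall T, A T -> S \o T = T \o S].

Definition center A : set (H -> H) := A `&` commutant A.

Definition von_neumann_algebra A : Prop :=
  [/\ A `<=` bounded_operator,
      forall T, A T -> exists2 S, A S & is_adjoint T S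
    & commutant (commutant A) = A].

Definition op_inv T : H -> H :=
  xget 0 [set S | [/\ bounded_operator S, S \o T = idfun & T \o S = idfun]].

Definition square_summable (v : nat -> H) : Prop :=
  cvgn (series (fun n => complex.Re (inner (v n) (v n)))).

(* The functional T |-> \sum_n <T v_n, w_n>. For square summable v and w, these
   are exactly the functionals defining the ultraweak topology of B(H). *)
Definition uw_functional (v w : nat -> H) T : R[i]^o :=
  limn (series (fun n => inner (T (v n)) (w n) : R[i]^o)).

Definition uw_cvg (F : set_system (H -> H)) T : Prop :=
  forall v w, square_summable v -> square_summable w ->
    uw_functional v w S @[S --> F] --> uw_functional v w T.

Definition uw_dense (D A : set (H -> H)) : Prop :=
  D `<=` A /\ forall T, A T ->
    exists F : set_system (H -> H), [/\ ProperFilter F, F D & uw_cvg F T].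

Definition linear_functional_on A (w : (H -> H) -> R[i]^o) : Prop :=
  forall (c : R[i]) S T, A S -> A T -> w (c *: S + T) = c * w S + w T.

Definition normal_functional A (w : (H -> H) -> R[i]^o) : Prop :=
  linear_functional_on A w /\
  forall (F : set_system (H -> H)) T, ProperFilter F -> F A -> A T ->
    uw_cvg F T -> w S @[S --> F] --> w T.

Definition positive_normal_functional A (w : (H -> H) -> R[i]^o) : Prop :=
  normal_functional A w /\ forall T, positive_part A T -> 0 <= w T.

(* ||w1 - w2|| <= e for the norm of the predual of A *)
Definition predual_dist_le A (w1 w2 : (H -> H) -> R[i]^o) (e : R) : Prop :=
  forall T, A T -> (forall v, `|T v| <= `|v|) -> `|w1 T - w2 T| <= e%:C%C.

Definition separable_predual A : Prop :=
  exists2 d : nat -> (H -> H) -> R[i]^o,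
    forall n, normal_functional A (d n) &
    forall w, normal_functional A w -> forall e : R, 0 < e ->
      exists n, predual_dist_le A w (d n) e.

Definition directed (D : set (H -> H)) : Prop :=
  D !=set0 /\ forall S T, D S -> D T ->
    exists U, [/\ D U, op_le S U & op_le T U].

(* T is the least upper bound of D in the positive part of A *)
Definition is_lub_in A (D : set (H -> H)) T : Prop :=
  [/\ positive_part A T, forall S, D S -> op_le S T
    & forall U, positive_part A U -> (forall S, D S -> op_le S U) -> op_le T U].

End Operators.

Section Maps.
Context {R : realType} {K H : hilbertType R}.

Definition linear_on (A : set (K -> K)) (f : (K -> K) -> (H -> H)) : Prop :=
  forall (c : R[i]) S T, A S -> A T -> f (c *: S + T) = c *: f S + f T.

Definition uw_continuous_on (A : set (K -> K)) (f : (K -> K) -> (H -> H)) : Prop :=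
  forall (F : set_system (K -> K)) T, ProperFilter F -> F A -> A T ->
    uw_cvg F T -> uw_cvg (f @ F) (f T).

Record vn_morphism (N : set (K -> K)) (M : set (H -> H))
    (f : (K -> K) -> (H -> H)) : Prop := VNMorphism {
  vnm_into : forall x, N x -> M (f x);
  vnm_linear : linear_on N f;
  vnm_mul : forall x y, N x -> N y -> f (x \o y) = f x \o f y;
  vnm_unital : f idfun = idfun;
  vnm_star : forall x xs, N x -> N xs -> is_adjoint x xs -> is_adjoint (f x) (f xs);
  vnm_inj : forall x y, N x -> N y -> f x = f y -> x = y;
  vnm_normal : uw_continuous_on N f
}.

End Maps.

Section Expectations.
Context {R : realType} {H : hilbertType R}.
Implicit Types (A B : set (H -> H)) (E : (H -> H) -> (H -> H)).

(* positivity of an n x n matrix of operators, as an operator on H^n *)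
Definition positive_op_matrix n (T : 'I_n -> 'I_n -> H -> H) : Prop :=
  forall v : 'I_n -> H, 0 <= \sum_i \sum_j inner (T i j (v j)) (v i).

Definition completely_positive_on B E : Prop :=
  forall n (T : 'I_n -> 'I_n -> H -> H), (forall i j, B (T i j)) ->
    positive_op_matrix T -> positive_op_matrix (fun i j => E (T i j)).

Record conditional_expectation B A E : Prop := ConditionalExpectation {
  ce_linear : linear_on B E;
  ce_unital : E idfun = idfun;
  ce_cp : completely_positive_on B E;
  ce_onto : E @` B = A;
  ce_bimodule : forall a1 b a2, A a1 -> B b -> A a2 ->
    E (a1 \o b \o a2) = a1 \o E b \o a2
}.

(* the set E(B, A) of normal faithful conditional expectations *)
Record nf_expectation B A E : Prop := NFExpectation {
  nfe_ce : conditional_expectation B A E;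
  nfe_normal : uw_continuous_on B E;
  nfe_faithful : forall b bs, B b -> is_adjoint b bs -> E (bs \o b) = 0 -> b = 0
}.

End Expectations.

Section Weights.
Context {R : realType} {H : hilbertType R}.
Implicit Types (A P Q : set (H -> H)) (phi psi : (H -> H) -> \bar R).
Local Open Scope ereal_scope.

(* normal faithful semifinite weights on A *)
Record nsf_weight A phi : Prop := NSFWeight {
  wt_ge0 : forall T, positive_part A T -> 0 <= phi T;
  wt_add : forall S T, positive_part A S -> positive_part A T ->
    phi (S + T)%R = phi S + phi T;
  wt_scale : forall (c : R) T, (0 <= c)%R -> positive_part A T ->
    phi (c%:C%C *: T)%R = c%:E * phi T;
  wt_normal : forall D T, D `<=` positive_part A -> directed D ->
    is_lub_in A D T -> phi T = ereal_sup [set phi S | S in D];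
  wt_faithful : forall T, positive_part A T -> phi T = 0 -> T = 0%R;
  wt_semifinite : uw_dense
    [set x | A x /\ exists2 xs, is_adjoint x xs & phi (xs \o x) < +oo] A
}.

(* The extended positive part of A (Haagerup): lower semicontinuous, additive,
   positively homogeneous functions on the positive cone of the predual. Elements
   of the predual are represented by functions on H -> H, whence ep_ext. *)
Record extended_positive A (m : ((H -> H) -> R[i]^o) -> \bar R) : Prop :=
    ExtendedPositive {
  ep_ext : forall w1 w2, positive_normal_functional A w1 ->
    positive_normal_functional A w2 -> (forall T, A T -> w1 T = w2 T) ->
    m w1 = m w2;
  ep_ge0 : forall w, positive_normal_functional A w -> 0 <= m w;
  ep_add : forall w1 w2, positive_normal_functional A w1 ->
    positive_normal_functional A w2 ->
    m (fun T => w1 T + w2 T)%R = m w1 + m w2;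
  ep_scale : forall (c : R) w, (0 <= c)%R -> positive_normal_functional A w ->
    m (fun T => c%:C%C * w T)%R = c%:E * m w;
  ep_lsc : forall w (t : \bar R), positive_normal_functional A w -> t < m w ->
    exists2 e : R, (0 < e)%R & forall w', positive_normal_functional A w' ->
      predual_dist_le A w' w e -> t < m w'
}.

(* the element m of the extended positive part of A is the operator b *)
Definition ext_is_operator A (m : ((H -> H) -> R[i]^o) -> \bar R) (b : H -> H) :=
  forall w, positive_normal_functional A w -> m w = (complex.Re (w b))%:E.

(* The value at m of the normal extension of the weight phi on A to the extended
   positive part: m is an increasing limit of bounded elements b <= m. *)
Definition weight_ext A phi (m : ((H -> H) -> R[i]^o) -> \bar R) : \bar R :=
  ereal_sup [set phi b | b in [set b | positive_part A b /\
    forall w, positive_normal_functional A w -> (complex.Re (w b))%:E <= m w]].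

(* normal faithful semifinite operator-valued weights from P to Q *)
Record nsf_operator_weight P Q
    (F : (H -> H) -> ((H -> H) -> R[i]^o) -> \bar R) : Prop := NSFOperatorWeight {
  ow_ext : forall x, positive_part P x -> extended_positive Q (F x);
  ow_add : forall x y w, positive_part P x -> positive_part P y ->
    positive_normal_functional Q w -> F (x + y)%R w = F x w + F y w;
  ow_scale : forall (c : R) x w, (0 <= c)%R -> positive_part P x ->
    positive_normal_functional Q w -> F (c%:C%C *: x)%R w = c%:E * F x w;
  ow_bimodule : forall a a_s x w, Q a -> is_adjoint a a_s -> Q a_s ->
    positive_part P x -> positive_normal_functional Q w ->
    F (a_s \o x \o a) w = F x (fun y => w (a_s \o y \o a));
  ow_normal : forall D T w, D `<=` positive_part P -> directed D ->
    is_lub_in P D T -> positive_normal_functional Q w ->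
    F T w = ereal_sup [set F S w | S in D];
  ow_faithful : forall x, positive_part P x ->
    (forall w, positive_normal_functional Q w -> F x w = 0) -> x = 0%R;
  ow_semifinite : uw_dense
    [set x | P x /\ exists2 xs, is_adjoint x xs &
       exists2 b, positive_part Q b & ext_is_operator Q (F (xs \o x)) b] P
}.

End Weights.

(* Connes' spatial derivative dphi/dpsi, for phi a weight on P and psi a weight on
   the commutant Q of P. *)
Section SpatialDerivative.
Context {R : realType} {H : hilbertType R}.
Variables (Q : set (H -> H)) (phi psi : (H -> H) -> \bar R).

(* psi-bounded vectors: those v for which R(v) : y |-> y v, defined on
   {y in Q | psi(y^* y) < +oo}, extends to a bounded operator from the GNS space
   of psi to H. *)
Definition psi_bounded (v : H) : Prop :=
  exists c : R, forall y ys, Q y -> is_adjoint y ys -> (psi (ys \o y) < +oo)%E ->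
    ((complex.Re (inner (y v) (y v)))%:E <= c%:E * psi (ys \o y))%E.

(* The operator theta(v, v) = R(v) R(v)^* on H: since the image of
   {y in Q | psi(y^* y) < +oo} is dense in the GNS space,
   <theta w, w> = ||R(v)^* w||^2 = sup {|<y v, w>|^2 | psi(y^* y) <= 1}. *)
Definition theta (v : H) : H -> H :=
  xget 0 [set T | [/\ bounded_operator T, op_le 0 T & forall w : H,
    (complex.Re (inner (T w) w))%:E = ereal_sup
      [set (complex.Re (`|inner (y v) w| ^+ 2))%:E | y in
        [set y | Q y /\
          exists2 ys, is_adjoint y ys & (psi (ys \o y) <= 1%:E)%E]]]].

(* the quadratic form v |-> phi(theta(v, v)) and its domain *)
Definition sd_dom (v : H) : Prop :=
  psi_bounded v /\ (phi (theta v) < +oo)%E.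

Definition sd_form (v : H) : R := fine (phi (theta v)).

Definition sd_polar (v w : H) : R[i]^o :=
  4%:R^-1 * \sum_(k < 4) 'i ^+ k * (sd_form (v + 'i ^+ k *: w))%:C%C.

(* Graph of dphi/dpsi, the positive self-adjoint operator associated with the
   closure of this (closable) quadratic form. *)
Definition spatial_derivative (v u : H) : Prop :=
  exists s : nat -> H,
  [/\ forall n, sd_dom (s n), s @ \oo --> v,
      forall e : R, 0 < e -> exists n0, forall m n, (n0 <= m)%N -> (n0 <= n)%N ->
        sd_form (s m - s n) < e
    & forall w, sd_dom w -> sd_polar (s n) w @[n --> \oo] --> (inner u w : R[i]^o)].

End SpatialDerivative.

Section Index.
Context {R : realType} {H : hilbertType R}.
Variables (B A : set (H -> H)) (E : (H -> H) -> (H -> H)).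

(* F = E^{-1}, from A' to B' *)
Definition inverse_operator_weight
    (F : (H -> H) -> ((H -> H) -> R[i]^o) -> \bar R) : Prop :=
  nsf_operator_weight (commutant A) (commutant B) F /\
  forall phi psi, nsf_weight A phi -> nsf_weight (commutant B) psi ->
    spatial_derivative (commutant B) (phi \o E) psi =
    spatial_derivative (commutant A) phi (weight_ext (commutant B) psi \o F).

(* E has finite index, and Ind(E) = E^{-1}(1) is the operator I *)
Definition has_finite_index (I : H -> H) : Prop :=
  center B I /\ exists2 F, inverse_operator_weight F &
    ext_is_operator (commutant B) (F idfun) I.

(* E'' = E(Ind(E))^{-1} E(Ind(E) . ), for I = Ind(E) *)
Definition bidual_expectation (I : H -> H) : (H -> H) -> (H -> H) :=
  fun x => op_inv (E I) \o E (I \o x).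

End Index.

(* Main.v *)
Require Import Defs.
From mathcomp Require Import all_boot all_order all_algebra.
From mathcomp Require Import complex.
From mathcomp Require Import all_classical all_reals all_analysis.

(** Write h for the index of E. The map E'' is again a unital conditional
    expectation, so evaluating it at 1 shows that op_inv (E h) is a left inverse
    of E h, hence a genuine two-sided one. Therefore E = E'' amounts to the
    identity E (h \o x) = E h \o E x for all x in M.

    If E h = h, then h lies in the range of E, and this identity is the bimodule
    property of E. Conversely, suppose that the identity holds. Since E h lies in
    the range of E, the bimodule property also gives E (E h \o x) = E h \o E x,
    so E ((h - E h) \o x) = 0 for all x in M. Taking for x the adjoint d^* of
    d = h - E h yields E (d \o d^* ) = 0, and d = 0 because E is faithful
    ([multiplicative_fixed]). *)

Import Order.TTheory GRing.Theory Num.Theory.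

Local Open Scope classical_set_scope.
Local Open Scope ring_scope.

Section OperatorAlgebra.
Context {R : realType} {H : hilbertType R}.
Implicit Types (A M : set (H -> H)) (S T : H -> H).

Lemma is_adjoint_sym S T : is_adjoint S T -> is_adjoint T S.
Proof. by move=> adjST v w; rewrite inner_conj -adjST -inner_conj. Qed.

Lemma inner0l (u : H) : inner 0 u = 0.
Proof.
have := inner_linearl 1 0 0 u; rewrite scaler0 addr0 mul1r => /eqP.
by rewrite -subr_eq0 opprD addrA subrr sub0r oppr_eq0 => /eqP.
Qed.

Lemma adjoint_eq0 S T : is_adjoint S T -> S = 0 -> T = 0.
Proof.
move=> adjST S0; apply/funext => v; apply/eqP.
by rewrite -normr_eq0 -sqrf_eq0 -inner_norm -adjST S0 inner0l.
Qed.

(** The bounding constant is a complex number without sign condition; its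
    absolute value bounds as well, and can be multiplied. *)
Lemma bounded_operator_norm T : bounded_operator T ->
  exists2 c : R[i], 0 <= c & forall v, `|T v| <= c * `|v|.
Proof.
move=> [_ [c bT]]; exists `|c| => // v.
have c_ge0 : 0 <= c * `|v| := le_trans (normr_ge0 _) (bT v).
by rewrite -[`|v|]normr_id -normrM ger0_norm.
Qed.

Lemma bounded_operator_comp S T :
  bounded_operator S -> bounded_operator T -> bounded_operator (S \o T).
Proof.
move=> bS bT; split=> [a u v|] /=; first by rewrite bT.1 bS.1.
have [c c_ge0 cS] := bounded_operator_norm _ bS.
have [d d_ge0 dT] := bounded_operator_norm _ bT.
exists (c * d) => v /=; apply: le_trans (cS _) _.
by rewrite -mulrA ler_wpM2l.
Qed.

Lemma bounded_operator_linear (a : R[i]) S T :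
  bounded_operator S -> bounded_operator T -> bounded_operator (a *: S + T).
Proof.
move=> bS bT; split=> [b u v|].
  rewrite !fctE bT.1 bS.1 !scalerDr !scalerA addrACA.
  by rewrite [a * b]mulrC.
have [c c_ge0 cS] := bounded_operator_norm _ bS.
have [d d_ge0 dT] := bounded_operator_norm _ bT.
exists (`|a| * c + d) => v; rewrite !fctE.
apply: le_trans (ler_normD _ _) _; rewrite normrZ mulrDl -mulrA.
by apply: lerD => //; apply: ler_wpM2l.
Qed.

Lemma commutant_comp A S T :
  commutant A S -> commutant A T -> commutant A (S \o T).
Proof.
move=> [bS cS] [bT cT]; split=> [|U AU]; first exact: bounded_operator_comp.
by rewrite -compA cT // compA cS.
Qed.

Lemma commutant_linear A (a : R[i]) S T : A `<=` bounded_operator ->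
  commutant A S -> commutant A T -> commutant A (a *: S + T).
Proof.
move=> bA [bS cS] [bT cT]; split=> [|U AU]; first exact: bounded_operator_linear.
apply/funext => v.
have [linU _] := bA _ AU.
have SUv := congr1 (@^~ v) (cS _ AU); have TUv := congr1 (@^~ v) (cT _ AU).
by move: SUv TUv; rewrite /= !fctE linU => <- <-.
Qed.

Lemma von_neumann_comp M S T :
  von_neumann_algebra M -> M S -> M T -> M (S \o T).
Proof. by move=> [_ _ <-]; exact: commutant_comp. Qed.

Lemma von_neumann_linear M (a : R[i]) S T :
  von_neumann_algebra M -> M S -> M T -> M (a *: S + T).
Proof. by move=> [_ _ <-]; apply: commutant_linear => ? []. Qed.

Lemma von_neumann_idfun M : von_neumann_algebra M -> M idfun.
Proof.
move=> [_ _ <-]; split=> //; split=> //.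
by exists 1 => v; rewrite mul1r.
Qed.

(** When T has no inverse, op_inv T is the junk value 0, which is a left inverse
    only if H = 0; in that case all operators are equal. *)
Lemma op_invr T : op_inv T \o T = idfun -> T \o op_inv T = idfun.
Proof.
rewrite /op_inv; case: xgetP => [S _ [] //|_ H0].
have trivial_H (u : H) : u = 0 by rewrite -[u]/(idfun u) -H0.
by apply/funext => u; rewrite (trivial_H u) [LHS]trivial_H.
Qed.

End OperatorAlgebra.

Section ConditionalExpectations.
Context {R : realType} {H : hilbertType R}.
Variables (M A : set (H -> H)) (E : (H -> H) -> (H -> H)).
Hypotheses (M_vn : von_neumann_algebra M) (A_sub : A `<=` M).

Lemma expectation_range x : conditional_expectation M A E -> M x -> A (E x).
Proof. by move=> E_ce Mx; rewrite -(ce_onto E_ce); exists x. Qed.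

Lemma expectation_mull a x :
  conditional_expectation M A E -> A a -> M x -> E (a \o x) = a \o E x.
Proof.
move=> E_ce Aa Mx; have M1 := von_neumann_idfun _ M_vn.
have A1 : A idfun by rewrite -(ce_unital E_ce); exact: expectation_range.
exact: (ce_bimodule E_ce Aa Mx A1).
Qed.

(** The left multiplicative domain of a faithful expectation is no larger than
    its range: a member h gives d = h - E h with E (d \o x) = 0 for all x, and
    at x = d^* faithfulness forces d = 0. *)
Lemma multiplicative_fixed h : nf_expectation M A E -> M h ->
  (forall x, M x -> E (h \o x) = E h \o E x) -> E h = h.
Proof.
move=> [E_ce _ E_faithful] Mh Emul.
have AEh := expectation_range _ E_ce Mh.
have MEh := A_sub _ AEh.
pose d := (-1) *: E h + h.
have Md : M d by exact: von_neumann_linear.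
have [_ /(_ _ Md) [ds Mds adj_d] _] := M_vn.
have Edds0 : E (d \o ds) = 0.
  have -> : d \o ds = (-1) *: (E h \o ds) + (h \o ds) by [].
  rewrite (ce_linear E_ce); try exact: von_neumann_comp.
  by rewrite expectation_mull // Emul // scaleN1r addNr.
have ds0 : ds = 0 by exact: (E_faithful ds d Mds (is_adjoint_sym _ _ adj_d) Edds0).
have := adjoint_eq0 _ _ (is_adjoint_sym _ _ adj_d) ds0.
by rewrite /d scaleN1r addrC => /eqP; rewrite subr_eq0 => /eqP.
Qed.

End ConditionalExpectations.

Theorem proposition4p4 (R : realType) (K H : hilbertType R)
  (N : set (K -> K)) (M : set (H -> H))
  (N_vn : von_neumann_algebra N) (N_sep : separable_predual N)
  (M_vn : von_neumann_algebra M) (M_sep : separable_predual M)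
  (iota : (K -> K) -> (H -> H)) (iota_mor : vn_morphism N M iota)
  (E : (H -> H) -> (H -> H)) (E_nf : nf_expectation M (iota @` N) E)
  (IndE : H -> H) (E_fin : has_finite_index M (iota @` N) E IndE)
  (E2_nf : nf_expectation M (iota @` N) (bidual_expectation E IndE)) :
  (forall x, M x -> E x = bidual_expectation E IndE x) <-> E IndE = IndE.
Proof.
have [[MI _] _] := E_fin.
have A_sub : iota @` N `<=` M by move=> _ [n Nn <-]; exact: vnm_into iota_mor _ Nn.
have E_ce := nfe_ce E_nf.
have EI_linv : op_inv (E IndE) \o E IndE = idfun := ce_unital (nfe_ce E2_nf).
split=> [E_bidual|EI x Mx].
- apply: (multiplicative_fixed _ _ _ M_vn A_sub _ E_nf MI) => x Mx.
  by rewrite (E_bidual x Mx) /bidual_expectation compA op_invr.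
- have AI : (iota @` N) IndE by rewrite -EI; exact: expectation_range E_ce MI.
  rewrite /bidual_expectation (expectation_mull _ _ _ M_vn _ _ E_ce AI Mx) compA.
  by rewrite -[X in _ \o X \o _]EI EI_linv.
Qed.
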